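(* Let $\underline\gamma^*=(\gamma_t^* )_{t=0}^{T-1}$, $\gamma_t^*:\mathcal P(\mathbb X)^K\to\mathbb U$, be a closed-loop (deterministic Markov) policy for the lifted problem. Then there exist deterministic functions $g_0^*,\dots,g_{T-1}^*:\mathcal P(\mathbb X)^K\to\mathbb U$, where $g_t^*$ is determined by $\Phi$ and $\gamma_0^*,\dots,\gamma_t^*$, such that for every initial state $(\mu_0^1,\dots,\mu_0^K)\in\mathcal P(\mathbb X)^K$, the trajectory generated by $\mu_{t+1}^k=\Phi(\mu_t^k,U_t^* )$ with $U_t^*=\gamma_t^*(\mu_t^1,\dots,\mu_t^K)$ satisfies $$U_t^*=g_t^*(\mu_0^1,\dots,\mu_0^K)\qquad\text{for all }t\in\{0,\dots,T-1\}.$$ That is, the closed-loop policy is equivalent to an initial-condition-dependent open-loop policy $(g_t^* )_{t=0}^{T-1}$.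
   Context: Fix integers $N,K,d,d_1,d_2,T\ge1$ and $\beta>0$. Let $\emptyset\ne\mathrm S\subset\mathbb R^d$, $\mathrm{PE}_N:=\{i/N:i=1,\dots,N\}$, $\mathbb X:=\mathrm{PE}_N\times\mathrm S$, with $\mathrm S$ compact. Let $\sigma:\mathbb R^{d_1}\to\mathbb R^{d_1}$ be $1$-Lipschitz. The action space $\mathbb U$ is a nonempty compact subset of $\mathbb R^{d\times d_1}\times\mathbb R^{d_1\times d}\times\mathbb R^{d_1}\times\mathbb R^{d_2\times d}\times\mathbb R^{d_2\times d}\times\mathbb R^{d\times d}$; its elements are written $U=(\mathsf W,\mathsf A,\mathsf b,\mathsf Q,\mathsf K,\mathsf V)$. $\mathcal P(\mathbb X)$ denotes the Borel probability measures on $\mathbb X$; for $\mu\in\mathcal P(\mathbb X)$, $\mu_{\mathrm S}$ is its marginal on $\mathrm S$. Define $f:\mathbb X\times\mathbb U\times\mathcal P(\mathbb X)\to\mathbb X$ by $$f((p,x),U,\mu):=\Big(p,\ \mathsf W\sigma(\mathsf Ax+\mathsf b)+\frac{\int_{\mathrm S}e^{\beta\langle\mathsf Qx,\mathsf Kz\rangle}\mathsf Vz\,\mu_{\mathrm S}(dz)}{\int_{\mathrm S}e^{\beta\langle\mathsf Qx,\mathsf Kz\rangle}\mu_{\mathrm S}(dz)}\Big);$$ it is a standing convention that $f$ is $\mathbb X$-valued. Let $\Phi(\mu,U):=\mu\circ f(\cdot,U,\mu)^{-1}$ (push-forward of $\mu$). A closed-loop policy is a sequence of measurable maps $\gamma_t:\mathcal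 P(\mathbb X)^K\to\mathbb U$, $t=0,\dots,T-1$, applied to the current state; the same action is applied to all $K$ measures. *)

(* Defs.v *)
From HB Require Import structures.
From mathcomp Require Import all_boot all_order all_algebra.
From mathcomp Require Import all_classical all_reals all_analysis.
From mathcomp Require Import measurable_realfun.
Set Implicit Arguments.
Unset Strict Implicit.
Unset Printing Implicit Defensive.
Import Order.TTheory GRing.Theory Num.Theory.
Import numFieldNormedType.Exports.
Local Open Scope classical_set_scope.
Local Open Scope ring_scope.

(* The set A with the subspace topology and the Borel sigma-algebra of that
   topology. Measurable types are pointed in the library, hence the argument
   A0. *)
Definition borel_sub (T : topologicalType) (A : set T) (A0 : A !=set0) : Type :=
  set_type A.

Section borel_sub_instances.
Context (T : topologicalType) (A : set T) (A0 : A !=set0).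

HB.instance Definition _ := Topological.copy (borel_sub A0) (set_type A).
HB.instance Definition _ := isPointed.Build (borel_sub A0)
  (SigSub (mem_set (projT2 (cid A0)))).
HB.instance Definition _ := @isMeasurable.Build
  (sigma_display (@open (borel_sub A0))) (borel_sub A0) <<s open >>
  (@sigma_algebra0 _ setT open) (@sigma_algebraC _ open)
  (@sigma_algebra_bigcup _ setT open).

Definition borel_sub_val (x : borel_sub A0) : T := set_val x.

Lemma borel_subP (x : borel_sub A0) : A (borel_sub_val x).
Proof. exact: set_valP. Qed.

Lemma borel_sub_val_continuous : continuous borel_sub_val.
Proof. exact: initial_continuous. Qed.

Lemma borel_sub_compact : compact A -> compact [set: borel_sub A0].
Proof.
move=> cA F FF _.
have FA : (borel_sub_val @ F) A.
  by apply: (@filterS _ F _ setT) filterT => x _; exact: (borel_subP x).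
have [p [Ap cp]] := cA _ _ FA.
exists (SigSub (mem_set Ap)); split => // B C FB.
rewrite nbhsE => -[C' [[D oD DC'] C'p] C'C].
have Dp : nbhs p D by apply: open_nbhs_nbhs; split => //; move: C'p; rewrite -DC'.
have FB' : (borel_sub_val @ F) (borel_sub_val @` B).
  by apply: (@filterS _ F _ B) FB => x Bx; exists x.
have [_ [[y By <-] Dy]] := cp _ _ FB' Dp.
by exists y; split => //; apply: C'C; rewrite -DC'.
Qed.

End borel_sub_instances.

Section continuous_measurable.

Lemma borel_sub_continuous (W T : topologicalType) (A : set T) (A0 : A !=set0)
    (f : W -> borel_sub A0) :
  continuous (@borel_sub_val _ _ A0 \o f) -> continuous f.
Proof. exact: continuous_comp_initial. Qed.

Lemma continuous_measurable_sub (T T' : topologicalType) (A : set T)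
    (B : set T') (A0 : A !=set0) (B0 : B !=set0)
    (f : borel_sub A0 -> borel_sub B0) :
  continuous f -> measurable_fun setT f.
Proof.
move=> /continuousP cf; apply: (@measurability _ _ (borel_sub A0) (borel_sub B0) setT f open erefl) => _ [C oC <-].
by rewrite setTI; apply: sub_sigma_algebra; exact: cf.
Qed.

Lemma continuous_measurable_real (R : realType) (T : topologicalType)
   (A : set T) (A0 : A !=set0) (f : borel_sub A0 -> R) :
  continuous f -> measurable_fun setT f.
Proof.
move=> /continuousP cf.
apply: (measurability _ (RGenOpens.measurableE R)) => // _ [_ [x [y ->]] <-].
by rewrite setTI; apply: sub_sigma_algebra; apply: cf; exact: interval_open.
Qed.

End continuous_measurable.
Section matrix_continuity.
Context {R : realType} (W : topologicalType).

Lemma continuous_mx m n (f : W -> 'M[R]_(m, n)) :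
  (forall i j, continuous (fun w => f w i j)) -> continuous f.
Proof.
move=> cf w A [P nP PA].
suff : \forall v \near w, forall i j, P i j (f v i j).
  by apply: filterS => v Pv; apply: PA => i j; exact: Pv.
by apply: filter_forall => i; apply: filter_forall => j; exact: cf.
Qed.

Lemma continuous_entry m n (f : W -> 'M[R]_(m, n)) i j :
  continuous f -> continuous (fun w => f w i j).
Proof. by move=> cf w; apply: continuous_comp (cf w) (@coord_continuous _ _ _ _ _ _). Qed.

Lemma continuous_bigsum (I : finType) (f : I -> W -> R) :
  (forall i, continuous (f i)) -> continuous (fun w => \sum_i f i w).
Proof. by move=> cf; apply: (continuous_big add_continuous). Qed.

Lemma continuous_mulmx m n p (C : 'M[R]_(m, n)) (f : W -> 'M[R]_(n, p)) :
  continuous f -> continuous (fun w => C *m f w).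
Proof.
move=> cf; apply: continuous_mx => i j.
rewrite (_ : (fun _ => _) = fun w => \sum_k C i k * f w k j); last first.
  by apply/funext => w; rewrite mxE.
apply: continuous_bigsum => k w.
by apply: cvgM; [exact: cvg_cst|exact: (continuous_entry cf)].
Qed.

End matrix_continuity.

Lemma continuous_pairing (W X Y Z : topologicalType) (h : X * Y -> Z)
    (f : W -> X) (g : W -> Y) :
  continuous h -> continuous f -> continuous g ->
  continuous (fun w => h (f w, g w)).
Proof.
move=> ch cf cg w.
exact: (cvg_comp _ _ (cvg_pair (cf w) (cg w)) (ch (f w, g w))).
Qed.

Section parametric_integral.
Context {R : realType} (T : topologicalType) (A : set T) (A0 : A !=set0).
Variable (nu : probability (borel_sub A0) R).
Hypothesis cA : compact A.

Lemma continuous_integrable (h : borel_sub A0 -> R) :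
  continuous h -> nu.-integrable setT (EFin \o h).
Proof.
move=> ch; apply: measurable_bounded_integrable => //.
- exact: le_lt_trans (probability_le1 nu measurableT) (ltry 1).
- exact: continuous_measurable_real.
- have /compact_bounded[M [Mr hM]] : compact (h @` setT).
    apply: continuous_compact; last exact: borel_sub_compact.
    exact: continuous_subspaceT.
  by exists M; split=> // N MN x _; apply: hM => //; exists x.
Qed.

Lemma continuous_Rintegral (W : topologicalType) (h : W -> borel_sub A0 -> R) :
  continuous (fun p : W * borel_sub A0 => h p.1 p.2) ->
  continuous (fun w => \int[nu]_z h w z).
Proof.
move=> ch.
have chw w : continuous (h w).
  apply: (@continuous_pairing _ _ _ _ _ (fun=> w) id ch) => z.
    exact: cst_continuous.
  exact: cvg_id.
move=> w; apply/cvgrPdist_le => e e0.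
have : \forall w' \near w, [set: borel_sub A0] `<=`
    (fun z => `|h w z - h w' z| <= e).
  apply: ((compact_near_coveringP [set: borel_sub A0]).1 (borel_sub_compact cA)
           W (nbhs w) (fun w' z => `|h w z - h w' z| <= e)) => z _.
  have : (fun p : borel_sub A0 * W => h w p.1 - h p.2 p.1) @ (z, w) --> (0:R).
    have cB : continuous (fun p : borel_sub A0 * W => h w p.1 - h p.2 p.1).
      move=> p; apply: cvgB; move: p.
        apply: (@continuous_pairing _ _ _ _ _ (fun=> w) fst ch) => p.
          exact: cst_continuous.
        exact: cvg_fst.
      apply: (@continuous_pairing _ _ _ _ _ snd fst ch) => p.
        exact: cvg_snd.
      exact: cvg_fst.
    by have := cB (z, w); rewrite /continuous_at/= subrr.
  move=> /cvgrPdist_le /(_ e e0); apply: filterS => -[z' w'] /=.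
  by rewrite sub0r normrN.
apply: filterS => w' hw'.
rewrite -RintegralB//; [|exact: continuous_integrable..].
have chB : continuous (fun z => h w z - h w' z).
  by move=> z; apply: continuousB; [exact: (chw w z)|exact: (chw w' z)].
apply: le_trans (le_normr_Rintegral _ (continuous_integrable chB)) _ => //.
apply: le_trans (_ : \int[nu]_z e <= e).
  apply: le_Rintegral => //.
  - apply: continuous_integrable => z.
    apply: (@continuous_comp _ _ _ (fun x => h w x - h w' x) Num.norm z (chB z)).
    exact: (@norm_continuous _ R^o).
  - by apply: continuous_integrable => z; exact: cst_continuous.
by rewrite Rintegral_cst// [X in fine X](probability_setT nu) mulr1.
Qed.

Lemma Rintegral_gt0 (h : borel_sub A0 -> R) :
  continuous h -> (forall z, 0 < h z) -> 0 < \int[nu]_z h z.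
Proof.
move=> ch h0.
have [|z0 _ hz0] := compact_EVT_min _ (borel_sub_compact (A0 := A0) cA)
  (continuous_subspaceT ch); first by exists point.
apply: lt_le_trans (h0 z0) _.
apply: le_trans (_ : _ <= \int[nu]_z h z0) _.
  by rewrite Rintegral_cst// [X in fine X](probability_setT nu) mulr1.
apply: le_Rintegral => //.
- by apply: continuous_integrable => z; exact: cst_continuous.
- exact: continuous_integrable.
- by move=> z _; apply: hz0; rewrite inE.
Qed.

End parametric_integral.

Section euclidean.
Context {R : realType} {n : nat}.
Implicit Types u v : 'cV[R]_n.

Definition dotp u v : R := \sum_i u i 0 * v i 0.

(* The library's norm on matrices is the maximum norm. *)
Definition enorm u : R := Num.sqrt (dotp u u).

Definition lipschitz1 (s : 'cV[R]_n -> 'cV[R]_n) :=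
  forall u v, enorm (s u - s v) <= enorm (u - v).

Lemma continuous_dotp (W : topologicalType) (f g : W -> 'cV[R]_n) :
  continuous f -> continuous g -> continuous (fun w => dotp (f w) (g w)).
Proof.
move=> cf cg; apply: continuous_bigsum => i w.
by apply: cvgM; [exact: (continuous_entry cf)|exact: (continuous_entry cg)].
Qed.

Lemma ler_entry_enorm u i j : `|u i j| <= enorm u.
Proof.
rewrite (ord1 j) -sqrtr_sqr ler_sqrt /dotp; last first.
  by apply: sumr_ge0 => k _; rewrite -expr2 sqr_ge0.
rewrite (bigD1 i)//= expr2 lerDl.
by apply: sumr_ge0 => k _; rewrite -expr2 sqr_ge0.
Qed.

Lemma lipschitz1_continuous s : lipschitz1 s -> continuous s.
Proof.
move=> sL; apply: continuous_mx => i j u.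
have cB : continuous (fun v : 'cV[R]_n => u - v).
  move=> v; apply: (@continuousB _ _ _ (fun=> u) id v).
    exact: cst_continuous.
  exact: cvg_id.
have : (fun v => enorm (u - v)) @ u --> (0 : R).
  have -> : (0 : R) = enorm (u - u).
    by rewrite /enorm /dotp big1 ?sqrtr0// => k _; rewrite !mxE subrr mulr0.
  apply: (@continuous_comp _ _ _ (fun v => dotp (u - v) (u - v)) Num.sqrt u).
    exact: (continuous_dotp cB cB).
  exact: sqrt_continuous.
move=> /cvgrPdist_le h; apply/(@cvgrPdist_le _ _ _ (nbhs u)) => e e0.
apply: (@filterS _ (nbhs u) _ _ _ _ (h e e0)) => v; rewrite sub0r normrN => uv.
apply: le_trans uv; apply: le_trans (ler_norm _).
apply: le_trans (sL u v).
by have := ler_entry_enorm (s u - s v) i j; rewrite !mxE.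
Qed.

End euclidean.

Section state_space.
Context {R : realType}.

Definition PE (N : nat) : set R :=
  [set i%:R / N%:R | i in [set i : nat | (1 <= i <= N)%N]].

Definition state_set (N d : nat) (S : set 'cV[R]_d) : set (R * 'cV[R]_d) :=
  PE N `*` S.

Lemma state_set_neq0 N d (S : set 'cV[R]_d) :
  (0 < N)%N -> S !=set0 -> state_set N S !=set0.
Proof.
by move=> N0 [x Sx]; exists (1%:R / N%:R, x); split => //; exists 1%N => //=.
Qed.

End state_space.

(* tuples (W, A, b, Q, K, V), with the product topology *)
Definition action_space (R : realType) (d d1 d2 : nat) : Type :=
  ('M[R]_(d, d1) * 'M[R]_(d1, d) * 'cV[R]_d1 *
   'M[R]_(d2, d) * 'M[R]_(d2, d) * 'M[R]_(d, d))%type.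

HB.instance Definition _ (R : realType) (d d1 d2 : nat) :=
  Topological.on (action_space R d d1 d2).

Section layer.
Context {R : realType} {d d1 d2 : nat}.
Implicit Types (U : action_space R d d1 d2) (x z : 'cV[R]_d).

Definition feed_forward (sigma : 'cV[R]_d1 -> 'cV[R]_d1) U x : 'cV[R]_d :=
  let: (W, A, b, _, _, _) := U in W *m sigma (A *m x + b).

Definition attention_weight (beta : R) U x z : R :=
  let: (_, _, _, Q, K, _) := U in expR (beta * dotp (Q *m x) (K *m z)).

Definition attention_value U z : 'cV[R]_d := let: (_, _, _, _, _, V) := U in V *m z.

Definition attention (beta : R) U (S : set 'cV[R]_d) (S0 : S !=set0)
    (nu : probability (borel_sub S0) R) x : 'cV[R]_d :=
  (\int[nu]_z attention_weight beta U x (borel_sub_val z))^-1 *: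
  \col_i \int[nu]_z (attention_weight beta U x (borel_sub_val z) *
                     attention_value U (borel_sub_val z) i 0).

Lemma feed_forward_continuous sigma U :
  lipschitz1 sigma -> continuous (feed_forward sigma U).
Proof.
move=> /lipschitz1_continuous csigma; case: U => -[[[[W A] b] Q] K] V /=.
apply: continuous_mulmx => x.
apply: (@continuous_comp _ _ _ (fun x => A *m x + b) sigma x); last exact: csigma.
apply: (@continuousD _ _ _ (fun x => A *m x) (fun=> b) x).
  by apply: continuous_mulmx => y; exact: cvg_id.
exact: cst_continuous.
Qed.

Lemma attention_continuous beta U (S : set 'cV[R]_d) (S0 : S !=set0)
    (nu : probability (borel_sub S0) R) :
  compact S -> continuous (attention beta U nu).
Proof.
move=> cS.
have cw : continuous (fun p : 'cV[R]_d * borel_sub S0 =>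
    attention_weight beta U p.1 (borel_sub_val p.2)).
  case: U => -[[[[W A] b] Q] K] V /= p.
  apply: (@continuous_comp _ _ _ (fun p : 'cV[R]_d * borel_sub S0 =>
    beta * dotp (Q *m p.1) (K *m borel_sub_val p.2)) expR p); last first.
    exact: continuous_expR.
  apply: (@continuousM _ _ (fun=> beta) (fun p : 'cV[R]_d * borel_sub S0 =>
    dotp (Q *m p.1) (K *m borel_sub_val p.2)) p); first exact: cst_continuous.
  apply: continuous_dotp; apply: continuous_mulmx => {}p; first exact: cvg_fst.
  apply: (@continuous_comp _ _ _ snd (@borel_sub_val _ _ S0) p).
    exact: cvg_snd.
  exact: borel_sub_val_continuous.
have cv i : continuous (fun p : 'cV[R]_d * borel_sub S0 =>
    attention_value U (borel_sub_val p.2) i 0).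
  case: U cw => -[[[[W A] b] Q] K] V _ /=.
  apply: continuous_entry; apply: continuous_mulmx => p.
  apply: (@continuous_comp _ _ _ snd (@borel_sub_val _ _ S0) p).
    exact: cvg_snd.
  exact: borel_sub_val_continuous.
apply: continuous_mx => i j.
rewrite (_ : (fun _ => _) = fun x =>
    (\int[nu]_z attention_weight beta U x (borel_sub_val z))^-1 *
    \int[nu]_z (attention_weight beta U x (borel_sub_val z) *
                attention_value U (borel_sub_val z) i 0)); last first.
  by apply/funext => x; rewrite !mxE.
move=> x.
have den_gt0 : 0 < \int[nu]_z attention_weight beta U x (borel_sub_val z).
  apply: Rintegral_gt0 => //.
    apply: (@continuous_pairing _ _ _ _ _ (fun=> x) id cw) => z.
      exact: cst_continuous.
    exact: cvg_id.
  by move=> z; case: U {cw cv} => -[[[[? ?] ?] ?] ?] ? /=; exact: expR_gt0.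
have cden := @continuous_Rintegral _ _ _ _ nu cS (matrix R d 1)
  (fun (x : 'cV[R]_d) (z : borel_sub S0) => attention_weight beta U x (borel_sub_val z)) cw.
have cnum := @continuous_Rintegral _ _ _ _ nu cS (matrix R d 1)
  (fun (x : 'cV[R]_d) (z : borel_sub S0) => attention_weight beta U x (borel_sub_val z) *
     attention_value U (borel_sub_val z) i 0).
apply: (continuousM (continuousV _ (cden x))); first by rewrite gt_eqF.
apply: cnum => p; apply: (@continuousM _ _ (fun p : 'cV[R]_d * borel_sub S0 =>
  attention_weight beta U p.1 (borel_sub_val p.2)) _ p (cw p)).
exact: cv.
Qed.

End layer.

(* P(X) with the sigma-algebra generated by the evaluations mu |-> mu B; X being
   separable metrizable, it is the Borel sigma-algebra of weak convergence. *)
Definition PX {R : realType} {N d : nat} (N0 : (0 < N)%N) {S : set 'cV[R]_d}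
    (S0 : S !=set0) :=
  pprobability (borel_sub (state_set_neq0 N0 S0)) R.

Section dynamics.
Context {R : realType} {N d d1 d2 : nat}.
Variables (N0 : (0 < N)%N) (S : set 'cV[R]_d) (S0 : S !=set0) (Sc : compact S).
Variables (UU : set (action_space R d d1 d2)) (UU0 : UU !=set0).
Variables (beta : R) (sigma : 'cV[R]_d1 -> 'cV[R]_d1).

Notation X := (borel_sub (state_set_neq0 N0 S0)).
Implicit Types (x : X) (U : borel_sub UU0) (mu : probability X R).

Definition token_of x : borel_sub S0 := SigSub (mem_set (borel_subP x).2).

Lemma token_of_continuous : continuous token_of.
Proof.
apply: borel_sub_continuous => x.
apply: (@continuous_comp _ _ _ (@borel_sub_val _ _ (state_set_neq0 N0 S0)) snd x).
  exact: borel_sub_val_continuous.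
exact: cvg_snd.
Qed.

Lemma token_of_measurable : measurable_fun setT token_of.
Proof. by apply: continuous_measurable_sub; exact: token_of_continuous. Qed.

(* the marginal mu_S *)
Definition token_marginal mu : probability (borel_sub S0) R :=
  distribution mu (mfun_Sub (mem_set token_of_measurable)).

Definition transformer_raw x U mu : R * 'cV[R]_d :=
  let p := (borel_sub_val x).1 in
  let y := (borel_sub_val x).2 in
  (p, feed_forward sigma (borel_sub_val U) y +
      attention beta (borel_sub_val U) (token_marginal mu) y).

Definition state_valued : Prop :=
  forall x U mu, state_set N S (transformer_raw x U mu).

Hypotheses (sigmaL : lipschitz1 sigma) (fX : state_valued).

Definition transformer x U mu : X := SigSub (mem_set (fX x U mu)).

Lemma transformer_continuous U mu :
  continuous (fun x => transformer x U mu).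
Proof.
have c1 : continuous (fun x => (borel_sub_val x).1).
  move=> x; apply: (@continuous_comp _ _ _
    (@borel_sub_val _ _ (state_set_neq0 N0 S0)) fst x); last exact: cvg_fst.
  exact: borel_sub_val_continuous.
have c2 : continuous (fun x => (borel_sub_val x).2).
  move=> x; apply: (@continuous_comp _ _ _
    (@borel_sub_val _ _ (state_set_neq0 N0 S0)) snd x); last exact: cvg_snd.
  exact: borel_sub_val_continuous.
have c3 : continuous (fun y => feed_forward sigma (borel_sub_val U) y +
    attention beta (borel_sub_val U) (token_marginal mu) y).
  move=> y; apply: (@continuousD _ _ _ (feed_forward sigma (borel_sub_val U))
    (attention beta (borel_sub_val U) (token_marginal mu)) y).
    exact: feed_forward_continuous.
  exact: attention_continuous.
have c32 : continuous (fun x => feed_forward sigma (borel_sub_val U) (borel_sub_val x).2 +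
    attention beta (borel_sub_val U) (token_marginal mu) (borel_sub_val x).2).
  by move=> x; apply: (@continuous_comp _ _ _ _ _ x (c2 x) (c3 _)).
apply: borel_sub_continuous => x.
exact: (@continuous_pairing _ _ _ _ id _ _ (fun p => cvg_id) c1 c32 x).
Qed.

Lemma transformer_measurable U mu :
  measurable_fun setT (fun x => transformer x U mu).
Proof. by apply: continuous_measurable_sub; exact: transformer_continuous. Qed.

Definition Phi (mu : PX N0 S0) U : PX N0 S0 :=
  distribution mu (mfun_Sub (mem_set (transformer_measurable U mu))).

End dynamics.

Section closed_loop.
Context {K T : nat} {P A : Type}.

(* gamma_0, ..., gamma_t *)
Definition policy_prefix (gamma : 'I_T -> K.-tuple P -> A) (t : 'I_T) :
    'I_t.+1 -> K.-tuple P -> A :=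
  fun s => gamma (widen_ord (ltn_ord t) s).

Definition closed_loop_trajectory (Psi : P -> A -> P)
    (gamma : 'I_T -> K.-tuple P -> A)
    (mu0 : K.-tuple P) (mu : nat -> K.-tuple P) (U : 'I_T -> A) : Prop :=
  mu 0%N = mu0 /\
  forall t : 'I_T, U t = gamma t (mu t) /\
    forall k, tnth (mu t.+1) k = Psi (tnth (mu t) k) (U t).

End closed_loop.

Arguments policy_prefix {K T P A} gamma t s.

(* Main.v *)
(** Substituting the closed-loop controls into the dynamics expresses the state
    at time s through mu_0 and gamma_0, ..., gamma_(s-1) alone; feeding this
    state to gamma_t gives the open-loop control at time t. *)

Require Import Defs.
From mathcomp Require Import all_boot all_order all_algebra.
From mathcomp Require Import all_classical all_reals all_analysis.
Import Order.TTheory GRing.Theory Num.Theory.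
Import numFieldNormedType.Exports.
Local Open Scope classical_set_scope.
Local Open Scope ring_scope.

Section open_loop.
Context {K : nat} {P A : Type}.
Implicit Types Psi : P -> A -> P.

(* [inord s'] is the intended index only when s' <= n; later states are junk. *)
Fixpoint replayed_state {n} Psi (gamma : 'I_n.+1 -> K.-tuple P -> A)
    (mu0 : K.-tuple P) (s : nat) : K.-tuple P :=
  if s is s'.+1 then
    let mu := replayed_state Psi gamma mu0 s' in
    [tuple Psi (tnth mu k) (gamma (inord s') mu) | k < K]
  else mu0.

(** A prefix ending at time n is the only policy data supplied, so dependence on later policies is
    excluded by typing; [ord_max] is time n. *)
Definition open_loop_control Psi {n} (gamma : 'I_n.+1 -> K.-tuple P -> A)
    (mu0 : K.-tuple P) : A :=
  gamma ord_max (replayed_state Psi gamma mu0 n).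

Context {T : nat}.
Implicit Types (gamma : 'I_T -> K.-tuple P -> A) (U : 'I_T -> A).

(** Induction on s with the prefix fixed: s <= t keeps every index given to [inord] inside the
    prefix. *)
Lemma closed_loop_replayed_state Psi gamma mu0 mu U (t : 'I_T) (s : nat) :
  closed_loop_trajectory Psi gamma mu0 mu U -> (s <= t)%N ->
  mu s = replayed_state Psi (policy_prefix gamma t) mu0 s.
Proof.
move=> [mu_0 step]; elim: s => [|s IHs] le_st //=.
have lt_sT : (s < T)%N := ltn_trans le_st (ltn_ord t).
have [Us mu_s] := step (Ordinal lt_sT).
apply: eq_from_tnth => k; rewrite tnth_mktuple -(IHs (ltnW le_st)) mu_s Us.
(* Both indices have value s: [inord] preserves it since s < t, and so does widening. *)
congr (Psi _ (gamma _ _)); apply: val_inj.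
by rewrite /= inordK// ltnW.
Qed.

Lemma closed_loop_open_loop Psi gamma mu0 mu U (t : 'I_T) :
  closed_loop_trajectory Psi gamma mu0 mu U ->
  U t = open_loop_control Psi (policy_prefix gamma t) mu0.
Proof.
move=> traj; have [Ut _] := traj.2 t.
rewrite Ut (closed_loop_replayed_state _ _ _ _ _ t t traj (leqnn t)).
(* The last index of the prefix widens to t itself. *)
by congr (gamma _ _); apply: val_inj.
Qed.

End open_loop.

Theorem mainTheorem9 (R : realType) (N K d d1 d2 T : nat)
    (N0 : (0 < N)%N) (K0 : (0 < K)%N) (d_gt0 : (0 < d)%N)
    (d1_gt0 : (0 < d1)%N) (d2_gt0 : (0 < d2)%N) (T0 : (0 < T)%N)
    (S : set 'cV[R]_d) (S0 : S !=set0) (Sc : compact S)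
    (UU : set (action_space R d d1 d2)) (UU0 : UU !=set0) (UUc : compact UU) :
  exists G : (PX N0 S0 -> borel_sub UU0 -> PX N0 S0) -> forall t : 'I_T,
      ('I_t.+1 -> K.-tuple (PX N0 S0) -> borel_sub UU0) ->
      K.-tuple (PX N0 S0) -> borel_sub UU0,
  forall (beta : R) (sigma : 'cV[R]_d1 -> 'cV[R]_d1)
    (beta_gt0 : 0 < beta) (sigma_lip : lipschitz1 sigma)
    (fX : state_valued N0 S0 UU0 beta sigma)
    (gamma : 'I_T -> K.-tuple (PX N0 S0) -> borel_sub UU0)
    (gamma_meas : forall t, measurable_fun [set: K.-tuple (PX N0 S0)] (gamma t)),
  exists g : 'I_T -> K.-tuple (PX N0 S0) -> borel_sub UU0,
    (forall t, g t = G (Phi Sc sigma_lip fX) t (policy_prefix gamma t)) /\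
    forall (mu0 : K.-tuple (PX N0 S0)) (mu : nat -> K.-tuple (PX N0 S0))
      (U : 'I_T -> borel_sub UU0),
      closed_loop_trajectory (Phi Sc sigma_lip fX) gamma mu0 mu U ->
      forall t, U t = g t mu0.
Proof.
(* [G] is chosen before [beta], [sigma] and the policy, so the dynamics and the prefix enter as
   arguments; t enters through the length of the prefix. *)
exists (fun Psi t gamma => open_loop_control Psi gamma) => beta sigma _ sigmaL fX gamma _.
exists (fun t => open_loop_control (Phi Sc sigmaL fX) (policy_prefix gamma t)).
by split=> // mu0 mu U traj t; exact: closed_loop_open_loop traj.
Qed.
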